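(* Let $$Q_i(\lambda,\mu)x_i=(A_i+\lambda B_i+\mu C_i+\lambda^2D_i+\lambda\mu E_i+\mu^2F_i)x_i=0,\quad i=1,2,$$ with $A_i,B_i,C_i,D_i,E_i,F_i\in\mathbb{C}^{n_i\times n_i}$, be a quadratic two-parameter eigenvalue problem. Let $e_1=[1\ 0\ 0]^T$. For $i=1,2$, let $0\neq\alpha_i\in\mathbb{C}$ and let $$Y_1^{(i)}=\begin{bmatrix}Y_{11}^{(i)}\\0\\0\end{bmatrix},\quad Z_1^{(i)}=\begin{bmatrix}Z_{11}^{(i)}\\Z_{21}^{(i)}\\Z_{31}^{(i)}\end{bmatrix},\quad Z_2^{(i)}=\begin{bmatrix}Z_{12}^{(i)}\\Z_{22}^{(i)}\\Z_{32}^{(i)}\end{bmatrix}\in\mathbb{C}^{3n_i\times n_i}$$ (partitioned into $n_i\times n_i$ blocks) satisfy $\det\begin{bmatrix}Z_{21}^{(i)}&Z_{22}^{(i)}\\Z_{31}^{(i)}&Z_{32}^{(i)}\end{bmatrix}\neq0$. Put $$A^{(i)}=\begin{bmatrix}Z_1^{(i)}&Z_2^{(i)}&\alpha_ie_1\otimes A_i\end{bmatrix},$$ $$B^{(i)}=\begin{bmatrix}\alpha_ie_1\otimes D_i&-Y_1^{(i)}+\alpha_ie_1\otimes E_i&-Z_1^{(i)}+\alpha_ie_1\otimes B_i\end{bmatrix},$$ $$C^{(i)}=\begin{bmatrix}Y_1^{(i)}&\alpha_ie_1\otimes F_i&-Z_2^{(i)}+\alpha_ie_1\otimes C_i\end{bmatrix}.$$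 Then the two-parameter eigenvalue problem $$L_i(\lambda,\mu)w_i=(A^{(i)}+\lambda B^{(i)}+\mu C^{(i)})w_i=0,\quad w_i=\Lambda\otimes x_i,\quad i=1,2,$$ is a linearization of the given quadratic two-parameter eigenvalue problem.
   Context: Here $\otimes$ is the Kronecker product, $I_k$ is the $k\times k$ identity matrix, and $\Lambda=\begin{bmatrix}\lambda\\ \mu\\ 1\end{bmatrix}$. A quadratic two-parameter eigenvalue problem asks for $(\lambda,\mu)\in\mathbb{C}\times\mathbb{C}$ and nonzero $x_i\in\mathbb{C}^{n_i}$ with $Q_i(\lambda,\mu)x_i=0$, $i=1,2$; a two-parameter eigenvalue problem asks for $(\lambda,\mu)$ and nonzero vectors $w_i$ with $L_i(\lambda,\mu)w_i=0$, $i=1,2$, where $L_i(\lambda,\mu)=A^{(i)}+\lambda B^{(i)}+\mu C^{(i)}$. An $ln\times ln$ linear matrix polynomial $L(\lambda,\mu)$ is a linearization of an $n\times n$ matrix polynomial $Q(\lambda,\mu)$ if there exist matrix polynomials $P(\lambda,\mu)$ and $R(\lambda,\mu)$ (of size $ln\times ln$), each with determinant a non-zero constant independent of $\lambda$ and $\mu$, such that $$\begin{bmatrix}Q(\lambda,\mu)&0\\0&I_{(l-1)n}\end{bmatrix}=P(\lambda,\mu)L(\lambda,\mu)R(\lambda,\mu).$$ The two-parameter eigenvalue problem $L_i(\lambda,\mu)w_i=0$, $i=1,2$, is said to be a linearization of the quadratic two-parameter eigenvalue problem $Q_i(\lambda,\mu)x_i=0$, $i=1,2$, if $L_i(\lambda,\mu)$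 is a linearization of $Q_i(\lambda,\mu)$ for $i=1,2$. *)

(* Defs.v *)
From mathcomp Require Export all_boot all_order all_algebra.
From mathcomp Require Export complex mxtens.
From mathcomp Require Export mpoly.
From mathcomp Require Export reals.

Set Implicit Arguments.
Unset Strict Implicit.
Unset Printing Implicit Defensive.

Import GRing.Theory.

Local Open Scope ring_scope.

(* In {mpoly K[2]}, the variable 'X_0 is lambda and 'X_1 is mu. *)
Definition Xlam (K : fieldType) : {mpoly K[2]} := 'X_(ord0 : 'I_2).
Definition Xmu (K : fieldType) : {mpoly K[2]} := 'X_(ord_max : 'I_2).
Arguments Xlam {K}.
Arguments Xmu {K}.

Definition const_mpmx (K : fieldType) (p q : nat) (A : 'M[K]_(p, q)) :
    'M[{mpoly K[2]}]_(p, q) :=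
  map_mx (@mpolyC 2 K) A.

Definition eval_mpmx (K : fieldType) (p q : nat)
    (M : 'M[{mpoly K[2]}]_(p, q)) (lam mu : K) : 'M[K]_(p, q) :=
  map_mx (meval (fun k : 'I_2 => if k == ord0 then lam else mu)) M.

Definition lin_mpmx (K : fieldType) (n : nat) (A B C : 'M[K]_n) :
    'M[{mpoly K[2]}]_n :=
  const_mpmx A + Xlam *: const_mpmx B + Xmu *: const_mpmx C.

Definition quad_mpmx (K : fieldType) (n : nat) (A B C D E F : 'M[K]_n) :
    'M[{mpoly K[2]}]_n :=
  const_mpmx A + Xlam *: const_mpmx B + Xmu *: const_mpmx C
  + Xlam ^+ 2 *: const_mpmx D + (Xlam * Xmu) *: const_mpmx E
  + Xmu ^+ 2 *: const_mpmx F.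

Definition is_linear_mpmx (K : fieldType) (n : nat)
    (L : 'M[{mpoly K[2]}]_n) : Prop :=
  exists A B C : 'M[K]_n, L = lin_mpmx A B C.

Definition nz_const_det (K : fieldType) (n : nat)
    (P : 'M[{mpoly K[2]}]_n) : Prop :=
  exists c : K, c != 0 /\ \det P = c%:MP.

(* The size factor is k.+1, so that the identity block has size k * n; the
   block matrix has the size of L because k.+1 * n converts to n + k * n. *)
Definition is_linearization (K : fieldType) (k n : nat)
    (L : 'M[{mpoly K[2]}]_(k.+1 * n)) (Q : 'M[{mpoly K[2]}]_n) : Prop :=
  is_linear_mpmx L /\
  exists P R : 'M[{mpoly K[2]}]_(k.+1 * n),
    [/\ nz_const_det P, nz_const_det R
      & block_mx Q 0 0 (1%:M : 'M_(k * n)) = P *m L *m R].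

(* A two-parameter eigenvalue problem is a pair of square matrix polynomials,
   indexed by 'I_2; each component has its own size. *)
Definition is_linearization_problem (K : fieldType) (k n : 'I_2 -> nat)
    (L : forall i, 'M[{mpoly K[2]}]_((k i).+1 * n i))
    (Q : forall i, 'M[{mpoly K[2]}]_(n i)) : Prop :=
  forall i, is_linearization (L i) (Q i).

Definition is_eigenpair (K : fieldType) (n : 'I_2 -> nat)
    (M : forall i, 'M[{mpoly K[2]}]_(n i))
    (lam mu : K) (x : forall i, 'cV[K]_(n i)) : Prop :=
  forall i, x i != 0 /\ eval_mpmx (M i) lam mu *m x i = 0.

Lemma add3n (n : nat) : (n + (n + n) = 3 * n)%N.
Proof. by rewrite !mulSn mul0n addn0. Qed.

Definition row3 (K : fieldType) (p n : nat) (X Y Z : 'M[K]_(p, n)) :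
    'M[K]_(p, 3 * n) :=
  castmx (erefl p, add3n n) (row_mx X (row_mx Y Z)).

Definition col3 (K : fieldType) (p n : nat) (X Y Z : 'M[K]_(n, p)) :
    'M[K]_(3 * n, p) :=
  castmx (add3n n, erefl p) (col_mx X (col_mx Y Z)).

Definition e1 (K : fieldType) : 'cV[K]_3 := delta_mx ord0 ord0.
Arguments e1 {K}.

Definition Lambda (K : fieldType) (lam mu : K) : 'cV[K]_3 :=
  \col_(k < 3) [:: lam; mu; 1]`_k.

(* Kronecker product with a column vector; the cast identifies the width
   1 * p with p. *)
Definition kron_col (K : fieldType) (m n p : nat) (v : 'cV[K]_m)
    (A : 'M[K]_(n, p)) : 'M[K]_(m * n, p) :=
  castmx (erefl (m * n)%N, mul1n p) (tensmx v A).

(* Main.v *)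
(* With V = Lambda (x) I, the columns of L satisfy L V = alpha e1 (x) Q.  Hence
   multiplying L on the right by R = [V, e1 (x) I, e2 (x) I], whose determinant
   is +-1, gives the block triangular matrix [alpha Q, X; 0, W], where W is the
   constant invertible matrix of the blocks Z21, Z22, Z31, Z32, and row
   operations P clear X and normalize the diagonal.  The first block column of R
   being V, evaluating P L R = diag(Q, I) at (lambda, mu) shows that the kernel
   of L is the image under V of the kernel of Q. *)
Require Import Defs.
From mathcomp Require Import ring.

Set Implicit Arguments.
Unset Strict Implicit.
Unset Printing Implicit Defensive.

Import GRing.Theory.

Local Open Scope ring_scope.

(** * Casts, block products and transfer of kernels *)

Lemma castmx_mul_sq (R : pzRingType) (m m' : nat) (e : m = m') (A B : 'M[R]_m) :
  castmx (e, e) (A *m B) = castmx (e, e) A *m castmx (e, e) B.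
Proof. by case: m' / e; rewrite !castmx_id. Qed.

Lemma det_castmx (R : comPzRingType) (m m' : nat) (e : m = m') (A : 'M[R]_m) :
  \det (castmx (e, e) A) = \det A.
Proof. by case: m' / e; rewrite castmx_id. Qed.

(** Needed to pass from the lower block of size [n + n], natural for block computations, to the size
    [2 * n] required by [is_linearization]. *)
Lemma castmx_block_id (R : pzSemiRingType) (n k m : nat) (e : k = m)
    (e' : n + k = n + m) (Q : 'M[R]_n) :
  castmx (e', e') (block_mx Q 0 0 (1%:M : 'M_k))
  = block_mx Q 0 0 (1%:M : 'M_m).
Proof. by case: m / e e' => e'; rewrite castmx_id. Qed.

Lemma lsubmx_castmx (R : Type) (p p' n k m : nat) (ep : p = p') (e : k = m)
    (e' : n + k = n + m) (A : 'M[R]_(p, n)) (B : 'M[R]_(p, k)) :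
  lsubmx (castmx (ep, e') (row_mx A B)) = castmx (ep, erefl n) A.
Proof.
by case: m / e e' => e'; case: p' / ep; rewrite !castmx_id row_mxKl.
Qed.

Lemma mul_row3_lambda (R : comPzRingType) (p n : nat) (a b : R)
    (U V W : 'M[R]_(p, n)) :
  row_mx U (row_mx V W)
    *m row_mx (col_mx a%:M (col_mx b%:M 1%:M))
              (row_mx (col_mx 1%:M (col_mx 0 0)) (col_mx 0 (col_mx 1%:M 0)))
  = row_mx (a *: U + (b *: V + W)) (row_mx U V).
Proof.
by rewrite !mul_mx_row !mul_row_col !mul_mx_scalar !mulmx0 !scale1r
   !addr0 !add0r.
Qed.

(** In the first block column, each of [Y11], [Z11], ..., [Z32] occurs twice with opposite signs and
    cancels, leaving only the quadratic terms in the top row. In the other two columns, [D], [E],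
    [F] and [Y11] are confined to the top row, so the lower right block is free of [l] and [m]. *)
Lemma pencil_mul_lambda (R : comPzRingType) (n : nat) (a l m : R)
    (A B C D E F Y11 Z11 Z21 Z31 Z12 Z22 Z32 : 'M[R]_n) :
  (row_mx (col_mx Z11 (col_mx Z21 Z31))
      (row_mx (col_mx Z12 (col_mx Z22 Z32)) (col_mx (a *: A) 0))
   + l *: row_mx (col_mx (a *: D) 0)
      (row_mx (col_mx (- Y11 + a *: E) 0)
              (col_mx (- Z11 + a *: B) (col_mx (- Z21) (- Z31))))
   + m *: row_mx (col_mx Y11 0)
      (row_mx (col_mx (a *: F) 0)
              (col_mx (- Z12 + a *: C) (col_mx (- Z22) (- Z32)))))
    *m row_mx (col_mx l%:M (col_mx m%:M 1%:M))
              (row_mx (col_mx 1%:M (col_mx 0 0)) (col_mx 0 (col_mx 1%:M 0)))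
  = block_mx
      (a *: (A + l *: B + m *: C + l ^+ 2 *: D + (l * m) *: E + m ^+ 2 *: F))
      (row_mx (Z11 + l *: (a *: D) + m *: Y11)
              (Z12 + l *: (- Y11 + a *: E) + m *: (a *: F)))
      0 (block_mx Z21 Z22 Z31 Z32).
Proof.
rewrite !scale_row_mx !scale_col_mx !scaler0 !add_row_mx !add_col_mx.
rewrite mul_row3_lambda !addr0 add0r !scale_col_mx !add_col_mx.
(* Regroup the three block rows as one plus two, so that both sides can be compared block by
   block. *)
rewrite -[X in row_mx _ X]block_mxEh block_mxEv -!block_mxEh.
congr block_mx; last rewrite -[RHS]col_mx0; last congr col_mx.
all: by apply/matrixP => i j; rewrite !mxE; ring.
Qed.

(** The kernel of [diag(Q, I)] consists of the vectors [col_mx x 0] with [Q *m x = 0], and the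
    invertible [R] carries it onto the kernel of [L]; on such vectors only the left block of [R]
    acts. *)
Lemma kernel_equivalent (K : fieldType) (n m : nat) (Q : 'M[K]_n)
    (P L R : 'M[K]_(n + m)) (w : 'cV[K]_(n + m)) :
    P \in unitmx -> R \in unitmx ->
    block_mx Q 0 0 1%:M = P *m L *m R ->
  (w != 0 /\ L *m w = 0) <->
  exists x : 'cV_n, w = lsubmx R *m x /\ (x != 0 /\ Q *m x = 0).
Proof.
move=> uP uR eqPLR.
have mulR (x : 'cV_n) : R *m col_mx x 0 = lsubmx R *m x.
  by rewrite -{1}[R]hsubmxK mul_row_col mulmx0 addr0.
have kerL (z : 'cV_(n + m)) :
    (L *m (R *m z) == 0) = (block_mx Q 0 0 1%:M *m z == 0).
  rewrite eqPLR -!mulmxA; apply/eqP/eqP => [->|]; first by rewrite mulmx0.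
  by move/(congr1 (mulmx (invmx P))); rewrite mulKmx // mulmx0.
split=> [[w0 Lw] | [x [-> [x0 Qx]]]].
  have: block_mx Q 0 0 1%:M *m (invmx R *m w) == 0.
    by rewrite -kerL mulKVmx // Lw.
  (* The identity block forces the lower part of [invmx R *m w] to vanish; its upper part is the
     required [x]. *)
  rewrite -[invmx R *m w]vsubmxK mul_block_col !mul0mx mul1mx addr0 add0r.
  rewrite col_mx_eq0 => /andP[/eqP Qx /eqP z2].
  have wE : w = lsubmx R *m usubmx (invmx R *m w).
    by rewrite -mulR -z2 vsubmxK mulKVmx.
  exists (usubmx (invmx R *m w)); split=> //; split=> //.
  by apply: contra_neq w0 => x0; rewrite wE x0 mulmx0.
split; last first.
  rewrite -mulR; apply/eqP; rewrite kerL mul_block_col Qx !mul0mx mulmx0.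
  by rewrite !addr0 col_mx0.
apply: contra_neq x0 => Rx.
have: invmx R *m (R *m col_mx x 0) == 0 by rewrite mulR Rx mulmx0.
by rewrite mulKmx // col_mx_eq0 => /andP[/eqP].
Qed.

(** * Matrix polynomials with constant determinant, evaluation, and three-block Kronecker
    products *)

Section MatrixPolynomials.
Variable K : fieldType.

Lemma nz_const_detM (n : nat) (P Q : 'M[{mpoly K[2]}]_n) :
  nz_const_det P -> nz_const_det Q -> nz_const_det (P *m Q).
Proof.
move=> [c [c0 dP]] [d [d0 dQ]]; exists (c * d).
by rewrite mulf_neq0 // det_mulmx dP dQ mpolyCM.
Qed.

Lemma nz_const_det_const (n : nat) (A : 'M[K]_n) :
  \det A != 0 -> nz_const_det (const_mpmx A).
Proof. by move=> A0; exists (\det A); rewrite A0 /const_mpmx det_map_mx. Qed.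

Lemma nz_const_det_ublock (n m : nat) (P : 'M[{mpoly K[2]}]_n)
    (S : 'M[{mpoly K[2]}]_(n, m)) (Q : 'M[{mpoly K[2]}]_m) :
  nz_const_det P -> nz_const_det Q -> nz_const_det (block_mx P S 0 Q).
Proof.
move=> [c [c0 dP]] [d [d0 dQ]]; exists (c * d).
by rewrite mulf_neq0 // det_ublock dP dQ mpolyCM.
Qed.

Lemma nz_const_det1 (n : nat) : nz_const_det (1%:M : 'M[{mpoly K[2]}]_n).
Proof. by exists 1; rewrite oner_neq0 det1. Qed.

Lemma nz_const_det_cast (n m : nat) (e : n = m) (P : 'M[{mpoly K[2]}]_n) :
  nz_const_det P -> nz_const_det (castmx (e, e) P).
Proof. by move=> [c [c0 dP]]; exists c; rewrite det_castmx. Qed.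

Lemma eval_mpmxM (p q r : nat) (M : 'M[{mpoly K[2]}]_(p, q))
    (N : 'M[{mpoly K[2]}]_(q, r)) (lam mu : K) :
  eval_mpmx (M *m N) lam mu = eval_mpmx M lam mu *m eval_mpmx N lam mu.
Proof. exact: map_mxM. Qed.

(** Evaluation commutes with the determinant and fixes constants, so the same nonzero value is
    obtained at every point. *)
Lemma eval_nz_const_det (n : nat) (P : 'M[{mpoly K[2]}]_n) (lam mu : K) :
  nz_const_det P -> eval_mpmx P lam mu \in unitmx.
Proof.
move=> [c [c0 dP]].
by rewrite unitmxE /eval_mpmx det_map_mx dP /= mevalC unitfE.
Qed.

Lemma const_mpmx1 (n : nat) : const_mpmx (1%:M : 'M[K]_n) = 1%:M.
Proof. exact: map_mx1. Qed.

Lemma const_mpmxZ (p q : nat) (a : K) (A : 'M[K]_(p, q)) :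
  const_mpmx (a *: A) = a%:MP *: const_mpmx A.
Proof. exact: map_mxZ. Qed.

Lemma const_mpmxM (p q r : nat) (A : 'M[K]_(p, q)) (B : 'M[K]_(q, r)) :
  const_mpmx (A *m B) = const_mpmx A *m const_mpmx B.
Proof. exact: map_mxM. Qed.

Lemma lin_mpmx_cast (n m : nat) (e : n = m) (A B C : 'M[K]_n) :
  lin_mpmx (castmx (e, e) A) (castmx (e, e) B) (castmx (e, e) C)
  = castmx (e, e) (lin_mpmx A B C).
Proof. by case: m / e; rewrite !castmx_id. Qed.

Lemma col3D (p n : nat) (X Y Z X' Y' Z' : 'M[K]_(n, p)) :
  col3 X Y Z + col3 X' Y' Z' = col3 (X + X') (Y + Y') (Z + Z').
Proof.
rewrite /col3; move: (add3n n); case: _ / => /=.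
by rewrite !castmx_id !add_col_mx.
Qed.

Lemma col3N (p n : nat) (X Y Z : 'M[K]_(n, p)) :
  - col3 X Y Z = col3 (- X) (- Y) (- Z).
Proof.
rewrite /col3; move: (add3n n); case: _ / => /=.
by rewrite !castmx_id !opp_col_mx.
Qed.

Lemma col3Z (p n : nat) (a : K) (X Y Z : 'M[K]_(n, p)) :
  a *: col3 X Y Z = col3 (a *: X) (a *: Y) (a *: Z).
Proof.
rewrite /col3; move: (add3n n); case: _ / => /=.
by rewrite !castmx_id !scale_col_mx.
Qed.

(** Merges the separate row and column casts into a single outer one, so that the block algebra can
    be done without casts. *)
Lemma row3_col3 (n : nat) (X1 X2 X3 Y1 Y2 Y3 Z1 Z2 Z3 : 'M[K]_n) :
  row3 (col3 X1 X2 X3) (col3 Y1 Y2 Y3) (col3 Z1 Z2 Z3)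
  = castmx (add3n n, add3n n)
      (row_mx (col_mx X1 (col_mx X2 X3))
        (row_mx (col_mx Y1 (col_mx Y2 Y3)) (col_mx Z1 (col_mx Z2 Z3)))).
Proof.
rewrite /row3 /col3; move: (add3n n); case: _ / => /=.
by rewrite !castmx_id.
Qed.

Lemma kron_colE (n p : nat) (v : 'cV[K]_3) (A : 'M[K]_(n, p)) :
  kron_col v A = col3 (v ord0 0 *: A) (v 1 0 *: A) (v ord_max 0 *: A).
Proof.
apply/matrixP => i j; rewrite !castmxE /= !cast_ord_id !mxE.
rewrite [(mxtens_unindex (cast_ord _ j)).1]ord1.
have -> : (mxtens_unindex (cast_ord (esym (mul1n p)) j)).2 = j.
  by apply: val_inj; rewrite /= modn_small.
(* Rows of the Kronecker product are numbered [a * n + b], with [a] the block and [b] the row inside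
   it; [splitP] then supplies [a] and [b] for each of the three blocks. *)
have unindexE (a : 'I_3) (b : 'I_n) : i = (a * n + b)%N :> nat ->
    mxtens_unindex i = (a, b).
  by move=> iE; rewrite -[RHS]mxtens_indexK; congr mxtens_unindex;
    apply: val_inj.
case: splitP => k ik.
  by rewrite (unindexE ord0 k) ?mxE.
rewrite mxE; case: splitP => l kl; rewrite mxE.
  by rewrite (unindexE 1 l) //; apply: (etrans ik); rewrite /= kl mul1n.
rewrite (unindexE ord_max l) //; apply: (etrans ik).
by rewrite /= kl mulSn mul1n addnA.
Qed.

Lemma kron_col_e1 (n p : nat) (A : 'M[K]_(n, p)) :
  kron_col e1 A = col3 A 0 0.
Proof. by rewrite kron_colE !mxE /= scale1r !scale0r. Qed.

Lemma kron_col_Lambda (n p : nat) (lam mu : K) (A : 'M[K]_(n, p)) :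
  kron_col (Lambda lam mu) A = col3 (lam *: A) (mu *: A) A.
Proof. by rewrite kron_colE !mxE /= scale1r. Qed.

(** The factors [P] and [R] serve both halves of the theorem: the first three clauses give the
    linearization, and the last one identifies the left block of [R] with the map sending [x] to its
    Kronecker product with [Lambda], which gives the form of the eigenvectors. *)
Lemma linearization_factors (n : nat) (A B C D E F : 'M[K]_n) (alpha : K)
    (Y11 Z11 Z21 Z31 Z12 Z22 Z32 : 'M[K]_n) :
    alpha != 0 -> \det (block_mx Z21 Z22 Z31 Z32) != 0 ->
  let Y1 := col3 Y11 0 0 in
  let Z1 := col3 Z11 Z21 Z31 in
  let Z2 := col3 Z12 Z22 Z32 in
  let LA := row3 Z1 Z2 (alpha *: kron_col e1 A) in
  let LB := row3 (alpha *: kron_col e1 D)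
                 (- Y1 + alpha *: kron_col e1 E)
                 (- Z1 + alpha *: kron_col e1 B) in
  let LC := row3 Y1
                 (alpha *: kron_col e1 F)
                 (- Z2 + alpha *: kron_col e1 C) in
  exists P R : 'M[{mpoly K[2]}]_(n + 2 * n),
    [/\ nz_const_det P, nz_const_det R,
        block_mx (quad_mpmx A B C D E F) 0 0 1%:M
          = P *m lin_mpmx LA LB LC *m R
      & forall lam mu (x : 'cV_n),
          lsubmx (eval_mpmx R lam mu) *m x = kron_col (Lambda lam mu) x].
Proof.
move=> alpha0 Z0 Y1 Z1 Z2 LA LB LC.
pose W := block_mx Z21 Z22 Z31 Z32.
pose Lam : 'M[{mpoly K[2]}]_(n + (n + n), n) :=
  col_mx Xlam%:M (col_mx Xmu%:M 1%:M).
pose R0 : 'M[{mpoly K[2]}]_(n + (n + n)) :=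
  row_mx Lam
    (row_mx (col_mx 1%:M (col_mx 0 0)) (col_mx 0 (col_mx 1%:M 0))).
pose X : 'M[{mpoly K[2]}]_(n, n + n) := row_mx
  (const_mpmx Z11 + Xlam *: (alpha%:MP *: const_mpmx D)
     + Xmu *: const_mpmx Y11)
  (const_mpmx Z12 + Xlam *: (- const_mpmx Y11 + alpha%:MP *: const_mpmx E)
     + Xmu *: (alpha%:MP *: const_mpmx F)).
(* This is the inverse of the block triangular matrix with diagonal [alpha], [W] and corner [X]; it
   is polynomial because [alpha] and [W] are constant and invertible. *)
pose P0 : 'M[{mpoly K[2]}]_(n + (n + n)) :=
  block_mx (const_mpmx alpha^-1%:M)
    (- (const_mpmx alpha^-1%:M *m X *m const_mpmx (invmx W)))
    0 (const_mpmx (invmx W)).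
have detR0 : nz_const_det R0.
  (* [R0] has block columns [Lam], first unit, second unit. Moving [Lam] to the last place makes it
     the unitriangular [U]; the constant block permutation [T] restores the order. *)
  pose U : 'M[{mpoly K[2]}]_(n + (n + n)) :=
    block_mx 1%:M (row_mx 0 Xlam%:M) 0 (block_mx 1%:M Xmu%:M 0 1%:M).
  pose T : 'M[K]_(n + (n + n)) := row_mx (col_mx 0 (col_mx 0 1%:M))
    (row_mx (col_mx 1%:M (col_mx 0 0)) (col_mx 0 (col_mx 1%:M 0))).
  have -> : R0 = U *m const_mpmx T.
    rewrite /const_mpmx !map_row_mx !map_col_mx !map_mx0 !map_mx1.
    rewrite !mul_mx_row !mul_block_col !mul_row_col !mulmx1 !mul1mx.
    by rewrite !mulmx0 !(addr0, add0r).
  apply: nz_const_detM.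
    apply: nz_const_det_ublock; first exact: nz_const_det1.
    by apply: nz_const_det_ublock; exact: nz_const_det1.
  apply: nz_const_det_const.
  (* Orthogonality shows that the determinant of [T] is nonzero without computing the sign of the
     permutation. *)
  have : T *m T^T = 1%:M.
    rewrite !tr_row_mx !tr_col_mx !trmx0 !trmx1 !mul_row_col !mul_col_row.
    rewrite !mulmx0 !mul0mx !mulmx1 !mul1mx !add_block_mx !(addr0, add0r).
    by rewrite row_mx0 col_mx0 -!scalar_mx_block.
  move/(congr1 determinant); rewrite det_mulmx det1 => dT.
  by apply: contra_eq_neq dT => ->; rewrite mul0r eq_sym oner_neq0.
have detP0 : nz_const_det P0.
  apply: nz_const_det_ublock; apply: nz_const_det_const.
    by rewrite det_scalar expf_neq0 // invr_eq0.
  by rewrite det_inv invr_eq0.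
pose Lp : 'M[{mpoly K[2]}]_(n + (n + n)) := lin_mpmx
  (row_mx (col_mx Z11 (col_mx Z21 Z31))
     (row_mx (col_mx Z12 (col_mx Z22 Z32)) (col_mx (alpha *: A) 0)))
  (row_mx (col_mx (alpha *: D) 0)
     (row_mx (col_mx (- Y11 + alpha *: E) 0)
             (col_mx (- Z11 + alpha *: B) (col_mx (- Z21) (- Z31)))))
  (row_mx (col_mx Y11 0)
     (row_mx (col_mx (alpha *: F) 0)
             (col_mx (- Z12 + alpha *: C) (col_mx (- Z22) (- Z32))))).
have LE : lin_mpmx LA LB LC = castmx (add3n n, add3n n) Lp.
  rewrite /LA /LB /LC /Y1 /Z1 /Z2 !kron_col_e1 !col3N !col3Z !col3D.
  rewrite !scaler0 !oppr0 !addr0 !row3_col3 lin_mpmx_cast.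
  by rewrite !col_mx0.
have LR : Lp *m R0 = block_mx
    (alpha%:MP *: quad_mpmx A B C D E F) X 0 (const_mpmx W).
  rewrite /Lp /lin_mpmx [const_mpmx W]map_block_mx /const_mpmx.
  rewrite !map_row_mx !map_col_mx !map_mx0 !map_mxD !map_mxN !map_mxZ.
  exact: pencil_mul_lambda.
have PLR : block_mx (quad_mpmx A B C D E F) 0 0 1%:M = P0 *m Lp *m R0.
  have VW : const_mpmx (invmx W) *m const_mpmx W = 1%:M.
    by rewrite -const_mpmxM mulVmx ?const_mpmx1 // unitmxE unitfE.
  rewrite -mulmxA LR mulmx_block !mulmx0 !mul0mx !addr0 VW add0r.
  (* The upper right block vanishes, since [invmx W] cancels [W] and leaves two equal terms in
     [X]. *)
  rewrite mulNmx -[X in _ - X]mulmxA VW mulmx1 subrr.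
  rewrite -scalemxAr scalemxAl -const_mpmxZ scale_scalar_mx mulfV //.
  by rewrite const_mpmx1 mul1mx.
exists (castmx (add3n n, add3n n) P0), (castmx (add3n n, add3n n) R0).
split; [exact: nz_const_det_cast | exact: nz_const_det_cast | |].
  rewrite LE -!castmx_mul_sq -PLR.
  by rewrite (castmx_block_id (m := (2 * n)%N)) // mulSn mul1n.
move=> lam mu x.
rewrite /eval_mpmx map_castmx map_row_mx lsubmx_castmx; last first.
  by rewrite mulSn mul1n.
(* The trivial cast put on [x] lets the cast of the left factor be moved outside the product. *)
rewrite kron_col_Lambda -[x in LHS](castmx_id (erefl n, erefl 1%N)).
rewrite -castmx_mul /col3 /Lam !map_col_mx map_mx1 !map_scalar_mx /=.
by rewrite !mevalXU !mul_col_mx !mul_scalar_mx scale1r.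
Qed.

End MatrixPolynomials.

Theorem theorem3p3 (R : realType) (n : 'I_2 -> nat)
    (A B C D E F : forall i : 'I_2, 'M[R[i]]_(n i))
    (alpha : 'I_2 -> R[i])
    (Y11 Z11 Z21 Z31 Z12 Z22 Z32 : forall i : 'I_2, 'M[R[i]]_(n i))
    (halpha : forall i, alpha i != 0)
    (hZ : forall i,
      \det (block_mx (Z21 i) (Z22 i) (Z31 i) (Z32 i)) != 0) :
  let Q (i : 'I_2) := quad_mpmx (A i) (B i) (C i) (D i) (E i) (F i) in
  let Y1 (i : 'I_2) := col3 (Y11 i) 0 0 in
  let Z1 (i : 'I_2) := col3 (Z11 i) (Z21 i) (Z31 i) in
  let Z2 (i : 'I_2) := col3 (Z12 i) (Z22 i) (Z32 i) in
  let LA (i : 'I_2) := row3 (Z1 i) (Z2 i) (alpha i *: kron_col e1 (A i)) in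
  let LB (i : 'I_2) := row3 (alpha i *: kron_col e1 (D i))
                            (- Y1 i + alpha i *: kron_col e1 (E i))
                            (- Z1 i + alpha i *: kron_col e1 (B i)) in
  let LC (i : 'I_2) := row3 (Y1 i)
                            (alpha i *: kron_col e1 (F i))
                            (- Z2 i + alpha i *: kron_col e1 (C i)) in
  let L (i : 'I_2) := lin_mpmx (LA i) (LB i) (LC i) in
  is_linearization_problem (k := fun=> 2%N) L Q /\
  (forall (lam mu : R[i]) (w : forall i : 'I_2, 'cV[R[i]]_(3 * n i)),
     is_eigenpair L lam mu w <->
     exists x : forall i : 'I_2, 'cV[R[i]]_(n i),
       (forall i, w i = kron_col (Lambda lam mu) (x i)) /\
       is_eigenpair Q lam mu x).
Proof.
move=> Q Y1 Z1 Z2 LA LB LC L.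
have factors i := linearization_factors (A i) (B i) (C i) (D i) (E i) (F i)
  (Y11 i) (Z11 i) (Z12 i) (halpha i) (hZ i).
split=> [i | lam mu w].
  have [P [S [dP dS PLS _]]] := factors i.
  by split; [exists (LA i), (LB i), (LC i) | exists P, S].
(* The two equations are coupled only through the common [(lam, mu)], so the correspondence of
   eigenvectors is proved for each [i] separately. *)
have eigen i : (w i != 0 /\ eval_mpmx (L i) lam mu *m w i = 0) <->
    exists x : 'cV_(n i), w i = kron_col (Lambda lam mu) x /\
      (x != 0 /\ eval_mpmx (Q i) lam mu *m x = 0).
  have [P [S [dP dS PLS lS]]] := factors i.
  have PLSe : block_mx (eval_mpmx (Q i) lam mu) 0 0 1%:M
      = eval_mpmx P lam mu *m eval_mpmx (L i) lam mu *m eval_mpmx S lam mu.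
    rewrite -!eval_mpmxM -PLS /eval_mpmx map_block_mx.
    by rewrite !(map_mx0, map_mx1).
  have := kernel_equivalent (w i) (eval_nz_const_det lam mu dP)
    (eval_nz_const_det lam mu dS) PLSe.
  by move=> ->; split=> -[x]; [rewrite lS | rewrite -lS]; exists x.
split=> [Lw | [x [wx Qx]] i]; last by apply/eigen; exists (x i).
(* Finite choice over ['I_2] gathers the eigenvectors found for each index into one family. *)
have [x xP] := fin_all_exists (fun i => (eigen i).1 (Lw i)).
by exists x; split=> i; case: (xP i).
Qed.
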